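(* Let $A\in\mathbb{R}^{N\times n}$ with $N\ge n\ge2$ have full column rank and columns of unit Euclidean norm, let $b\in\mathbb{R}^N$, and let $x^\star=\arg\min_x\|Ax-b\|_2$. Let $X=A^TA$, $\rho_2=\max_l\frac1n\sum_{r=1}^nX_{lr}^2$, $\sigma_{\max}$ the largest singular value of $A$, and $\kappa$ the ratio of the largest to the smallest singular value of $A$. Consider the iteration defined in the context with $0\le\beta<1$, deterministic $x_0$, nonnegative integer $\tau$, and deterministic sets $K(j)$ with $\{i:0\le i\le j-\tau-1\}\subseteq K(j)\subseteq\{0,\dots,j-1\}$. Let $\omega_\tau(\beta)=2\beta(1-\beta-\rho_2\tau^2\beta/2)$ and suppose $\omega_\tau(\beta)>0$. Then: (a) For every integer $m\ge\frac{\log(1/2)}{\log(1-\sigma_{\max}^2/n)}$, \[\mathbb{E}\big[\|x_m-x^\star\|_X^2\big]\le\Big(1-\frac{\omega_\tau(\beta)}{2\kappa^2}\Big)\|x_0-x^\star\|_X^2.\] (b) Let $T_0=\big\lceil\frac{\log(1/2)}{\log(1-\sigma_{\max}^2/n)}\big\rceil$, $T=T_0+\tau$, and \[\chi(\beta)=\frac{\rho_2\tau^3\beta^2\sigma_{\max}^2(1-\sigma_{\max}^2/n)^{-2\tau}}{n}.\] Then for every integer $r\ge1$ and every $m\ge rT$, \[\mathbb{E}\big[\|x_m-x^\star\|_X^2\big]\le\Big(1-\frac{\omega_\tau(\beta)}{2\kappa^2}\Big)\Big(1-\frac{\omega_\tau(\beta)(1-\sigma_{\max}^2/n)^{\ta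u}}{2\kappa^2}+\chi(\beta)\Big)^{r-1}\|x_0-x^\star\|_X^2.\]
   Context: $\|v\|_X^2:=v^TXv$ for $X=A^TA$. $e^{(1)},\dots,e^{(n)}$ are the standard basis vectors of $\mathbb{R}^n$. The iteration: let $d_0,d_1,\dots$ be i.i.d. random vectors, each uniformly distributed on $\{e^{(1)},\dots,e^{(n)}\}$; $K(0),K(1),\dots$ are deterministic sets (not depending on the $d_j$); given $x_0\in\mathbb{R}^n$ and step size $\beta$, define recursively for $j\ge0$ \[x_{K(j)}=x_0+\sum_{i\in K(j)}\beta\gamma_id_i,\qquad \gamma_j=d_j^TA^T(b-Ax_{K(j)}),\qquad x_{j+1}=x_j+\beta\gamma_jd_j.\] *)

(* Defs.v *)
(* classical reals (needed for ln). Matrices/vectors are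
   represented as functions on nat indices; only indices < dimension matter. *)
From Stdlib Require Import Reals Lra Lia ZArith Arith.
Open Scope R_scope.

Fixpoint sumR (k : nat) (f : nat -> R) : R :=
  match k with
  | O => 0
  | S k' => sumR k' f + f k'
  end.

Definition matvec (n : nat) (A : nat -> nat -> R) (x : nat -> R) : nat -> R :=
  fun i => sumR n (fun j => A i j * x j).

Definition sqnorm (k : nat) (v : nat -> R) : R := sumR k (fun i => v i * v i).

Definition gram (N : nat) (A : nat -> nat -> R) : nat -> nat -> R :=
  fun l r => sumR N (fun i => A i l * A i r).

Definition normX (N n : nat) (A : nat -> nat -> R) (v : nat -> R) : R :=
  sumR n (fun l => sumR n (fun r => v l * gram N A l r * v r)).

Definition e_ (c l : nat) : R := if Nat.eqb c l then 1 else 0.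

(* Given the realisation s (s j = index c of d_j = e^(c)), compute
   gam_upto k i = gamma_i for i < k (and 0 otherwise), by recursion on k:
   x_{K(k)} = x0 + sum_{i in K(k)} beta gamma_i d_i  (K(k) subset {0..k-1}),
   gamma_k  = d_k^T A^T (b - A x_{K(k)}). *)
Fixpoint gam_upto (N n : nat) (A : nat -> nat -> R) (b x0 : nat -> R) (beta : R)
    (K : nat -> nat -> bool) (s : nat -> nat) (k : nat) : nat -> R :=
  match k with
  | O => fun _ => 0
  | S k' =>
    let g := gam_upto N n A b x0 beta K s k' in
    let xK := fun l => x0 l +
        sumR k' (fun i => if K k' i then beta * g i * e_ (s i) l else 0) in
    let gk := sumR N (fun r => A r (s k') * (b r - matvec n A xK r)) in
    fun i => if Nat.ltb i k' then g i else if Nat.eqb i k' then gk else 0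
  end.

Definition gamma (N n : nat) A b x0 beta K s (j : nat) : R :=
  gam_upto N n A b x0 beta K s (S j) j.

Definition iterate (N n : nat) A b x0 beta K s (m : nat) : nat -> R :=
  fun l => x0 l + sumR m (fun j => beta * gamma N n A b x0 beta K s j * e_ (s j) l).

(* Expectation of F(d_0, ..., d_{m-1}) when the d_j are i.i.d. uniform on
   {e^(0),...,e^(n-1)}: the average over all index sequences of length m
   (entries beyond m are set to 0; F must depend only on the first m). *)
Fixpoint expect (n m : nat) (F : (nat -> nat) -> R) : R :=
  match m with
  | O => F (fun _ => 0%nat)
  | S m' => / INR n * sumR n (fun c =>
      expect n m' (fun s => F (fun i => match i with O => c | S i' => s i' end)))
  end.

Definition nat_ceil (x : R) : nat := Z.to_nat (- Int_part (- x)).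

(* Main.v *)
Require Import Defs.
From Stdlib Require Import Reals ZArith Arith Lra Lia FunctionalExtensionality.
Open Scope R_scope.

(* Let x_T denote x_0 plus the updates whose index lies in T. Minimising along a coordinate direction
   shows that one update multiplies E|x_T - x*|_X^2 by at least q = 1 - smax^2 / n, whatever its step,
   so the stale reads x_K(j) keep residuals E gamma_j^2 >= (smin^2 / n) q^j |x_0 - x*|_X^2. Expanding
   the square, update j lowers the energy by 2 beta (1 - beta) E gamma_j^2 up to the penalty
   beta^2 tau rho_2 sum_i E gamma_i^2 over the at most tau updates i it may have missed. Adding to the
   energy the penalties still to be paid gives a potential V with V_{j+1} <= V_j - omega E gamma_j^2;
   summing yields (a).
   For (b), if chi is at least omega q^tau / (2 kappa^2) the claim follows from (a). Otherwise
   chi <= 1/4, and applying the same expansion to the partial iterates that build up a stale read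
   gives q^tau E|x_K(i) - x*|_X^2 <= C E|x_i - x*|_X^2 with C = 4/3 (C = 1 if tau = 1). This bounds the
   pending penalties at the start of an epoch by chi times the energy. *)

(** * Finite sums *)

Lemma sumR_ext k f g :
  (forall i, (i < k)%nat -> f i = g i) -> sumR k f = sumR k g.
Proof.
  induction k as [|k IH]; intros H; simpl; [reflexivity|].
  rewrite IH by (intros; apply H; lia). rewrite H by lia. reflexivity.
Qed.

Lemma sumR_le k f g :
  (forall i, (i < k)%nat -> f i <= g i) -> sumR k f <= sumR k g.
Proof.
  induction k as [|k IH]; intros H; simpl; [lra|].
  apply Rplus_le_compat; [apply IH; intros; apply H; lia | apply H; lia].
Qed.

Lemma sumR_plus k f g : sumR k (fun i => f i + g i) = sumR k f + sumR k g.
Proof. induction k as [|k IH]; simpl; [lra | rewrite IH; ring]. Qed.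

Lemma sumR_scal k a f : sumR k (fun i => a * f i) = a * sumR k f.
Proof. induction k as [|k IH]; simpl; [lra | rewrite IH; ring]. Qed.

Lemma sumR_const k a : sumR k (fun _ => a) = INR k * a.
Proof. induction k as [|k IH]; [simpl; lra|]. rewrite S_INR; simpl; rewrite IH; ring. Qed.

Lemma sumR_zero k f : (forall i, (i < k)%nat -> f i = 0) -> sumR k f = 0.
Proof. intros H. rewrite (sumR_ext k f (fun _ => 0)), sumR_const by exact H. ring. Qed.

Lemma sumR_nonneg k f : (forall i, (i < k)%nat -> 0 <= f i) -> 0 <= sumR k f.
Proof.
  intros H. pose proof (sumR_le k (fun _ => 0) f H) as H0.
  now rewrite sumR_const, Rmult_0_r in H0.
Qed.

Lemma sumR_swap a b (f : nat -> nat -> R) :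
  sumR a (fun i => sumR b (fun j => f i j)) = sumR b (fun j => sumR a (fun i => f i j)).
Proof.
  induction a as [|a IH]; simpl; [now rewrite sumR_zero|].
  now rewrite IH, sumR_plus.
Qed.

Lemma sumR_S_head k f : sumR (S k) f = f 0%nat + sumR k (fun i => f (S i)).
Proof. induction k as [|k IH]; [simpl; lra|]. simpl sumR in *. rewrite IH. ring. Qed.

Lemma sumR_rev k f : sumR k f = sumR k (fun i => f (k - 1 - i)%nat).
Proof.
  induction k as [|k IH]; [reflexivity|].
  rewrite (sumR_S_head k (fun i => f (S k - 1 - i)%nat)). cbn [sumR].
  rewrite IH, Rplus_comm. f_equal.
  - f_equal; lia.
  - apply sumR_ext; intros; f_equal; lia.
Qed.

Lemma sumR_split a b f : sumR (a + b) f = sumR a f + sumR b (fun i => f (a + i)%nat).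
Proof.
  induction b as [|b IH]; [rewrite Nat.add_0_r; simpl; lra|].
  rewrite Nat.add_succ_r; simpl; rewrite IH; ring.
Qed.

Lemma sumR_e n c f : (c < n)%nat -> sumR n (fun r => f r * e_ c r) = f c.
Proof.
  unfold e_. induction n as [|n IH]; intros Hc; [lia|]. simpl.
  destruct (Nat.eqb_spec c n) as [->|Hne].
  - rewrite sumR_zero; [ring|]. intros i Hi. destruct (Nat.eqb_spec n i); [lia|ring].
  - rewrite IH by lia. ring.
Qed.

Lemma sumR_id t : 2 * sumR t (fun p => INR t - INR p) = INR t * (INR t + 1).
Proof.
  induction t as [|t IH]; [simpl; lra|].
  rewrite sumR_S_head, (sumR_ext t _ (fun p => INR t - INR p)).
  - rewrite Rmult_plus_distr_l, IH, S_INR. simpl. ring.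
  - intros; rewrite !S_INR; ring.
Qed.

Lemma sumR_geom m q : (1 - q) * sumR m (fun j => q ^ j) = 1 - q ^ m.
Proof. induction m as [|m IH]; simpl; [lra|]. rewrite Rmult_plus_distr_l, IH. ring. Qed.

Lemma sumR_sqr_le k f : (sumR k f) ^ 2 <= INR k * sumR k (fun i => f i ^ 2).
Proof.
  induction k as [|k IH]; [simpl; lra|].
  assert (Hc : 2 * f k * sumR k f <= sumR k (fun i => f i ^ 2) + INR k * f k ^ 2).
  { rewrite <- sumR_const, <- sumR_plus, <- sumR_scal.
    apply sumR_le; intros i _. pose proof (pow2_ge_0 (f i - f k)). lra. }
  rewrite S_INR. cbn [sumR]. lra.
Qed.

(* Padding by [0] before time [0] lets the windows that start there be summed like all others. *)
Definition back (l : nat) (f : nat -> R) (p : nat) : R :=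
  if Nat.ltb p l then f (l - 1 - p)%nat else 0.

(** Both sides are cut from one sum of [back l f] over [l + t] positions: the padding kills those
    from [l] on, the hypothesis those from [t] on. *)
Lemma sumR_window t l f :
  (forall k, (k + t < l)%nat -> f k = 0) -> sumR l f = sumR t (back l f).
Proof.
  intros Hf.
  assert (H1 : sumR (l + t) (back l f) = sumR l f).
  { rewrite sumR_split, (sumR_zero t), Rplus_0_r, (sumR_rev l f).
    - apply sumR_ext; intros i Hi; unfold back. destruct (Nat.ltb_spec i l); [reflexivity|lia].
    - intros i _; unfold back. destruct (Nat.ltb_spec (l + i) l); [lia|reflexivity]. }
  rewrite <- H1, Nat.add_comm, sumR_split, (sumR_zero l); [ring|].
  intros i _; unfold back. destruct (Nat.ltb_spec (t + i) l); [apply Hf; lia|reflexivity].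
Qed.

(** * Expectations over uniform index sequences *)

Definition upd (s : nat -> nat) (l c : nat) : nat -> nat :=
  fun i => if Nat.eqb i l then c else s i.

Lemma expect_le n m F G : (0 < n)%nat ->
  (forall s, (forall i, (s i < n)%nat) -> F s <= G s) ->
  expect n m F <= expect n m G.
Proof.
  intros Hn. revert F G. induction m as [|m IH]; intros F G H; simpl.
  (* The default index 0 beyond the horizon is admissible because [0 < n]. *)
  - now apply H.
  - apply Rmult_le_compat_l; [left; apply Rinv_0_lt_compat, lt_0_INR; lia|].
    apply sumR_le; intros c Hc. apply IH. intros s Hs. apply H.
    intros [|i]; auto.
Qed.

Lemma expect_ext n m F G : (0 < n)%nat ->
  (forall s, (forall i, (s i < n)%nat) -> F s = G s) ->
  expect n m F = expect n m G.
Proof.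
  intros Hn H. apply Rle_antisym; apply expect_le; auto; intros s Hs; rewrite H; auto; lra.
Qed.

Lemma expect_plus n m F G :
  expect n m (fun s => F s + G s) = expect n m F + expect n m G.
Proof.
  revert F G. induction m as [|m IH]; intros F G; simpl; [reflexivity|].
  rewrite <- Rmult_plus_distr_l, <- sumR_plus. f_equal.
  apply sumR_ext; intros c _. apply IH.
Qed.

Lemma expect_scal n m a F : expect n m (fun s => a * F s) = a * expect n m F.
Proof.
  revert F. induction m as [|m IH]; intros F; simpl; [reflexivity|].
  rewrite (sumR_ext n _ _ (fun c _ => IH _)), sumR_scal. ring.
Qed.

Lemma expect_const n m a : (0 < n)%nat -> expect n m (fun _ => a) = a.
Proof.
  intros Hn. induction m as [|m IH]; simpl; [reflexivity|].
  rewrite IH, sumR_const. field. apply not_0_INR; lia.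
Qed.

Lemma expect_sum n m k (F : nat -> (nat -> nat) -> R) : (0 < n)%nat ->
  expect n m (fun s => sumR k (fun i => F i s)) = sumR k (fun i => expect n m (F i)).
Proof.
  intros Hn. induction k as [|k IH]; simpl; [now apply expect_const|].
  now rewrite expect_plus, IH.
Qed.

(** Coordinate [l] is uniform and independent of the others, so redrawing it keeps the mean. This
    takes the place of conditioning on the other indices. *)
Lemma expect_resample n m l F : (0 < n)%nat -> (l < m)%nat ->
  expect n m F = expect n m (fun s => / INR n * sumR n (fun c => F (upd s l c))).
Proof.
  intros Hn. revert l F. induction m as [|m IH]; intros l F Hl; [lia|]. simpl.
  destruct l as [|l].
  - f_equal.
    (* Once position 0 is redrawn the outer choice [c] no longer matters, so [n] equal terms are
       averaged. *)
    rewrite (sumR_ext n (fun c => expect n m (fun s => / INR n * _))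
      (fun _ => / INR n * sumR n (fun c => expect n m
         (fun s => F (fun i => match i with O => c | S i' => s i' end))))).
    + rewrite sumR_const. field. apply not_0_INR; lia.
    + intros c Hc. rewrite expect_scal, expect_sum by exact Hn. f_equal.
      apply sumR_ext; intros a _. f_equal. apply functional_extensionality; intros s.
      f_equal. apply functional_extensionality; intros [|i]; reflexivity.
  - f_equal. apply sumR_ext; intros c _.
    rewrite (IH l) by lia. f_equal. apply functional_extensionality; intros s. f_equal.
    apply sumR_ext; intros a _. f_equal. apply functional_extensionality; intros [|i]; reflexivity.
Qed.

(** * Powers and shifted windows *)

Lemma pow_le_antitone q a b : 0 <= q <= 1 -> (a <= b)%nat -> q ^ b <= q ^ a.
Proof.
  intros Hq Hab. replace b with (a + (b - a))%nat by lia. rewrite pow_add.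
  pose proof (pow_le q a (proj1 Hq)). pose proof (pow_incr q 1 (b - a) Hq) as H1.
  rewrite pow1 in H1. nra.
Qed.

Lemma back_succ_S l f p : back (S l) f (S p) = back l f p.
Proof.
  unfold back. change (Nat.ltb (S p) (S l)) with (Nat.ltb p l).
  destruct (Nat.ltb p l); [f_equal; lia | reflexivity].
Qed.

Lemma back_succ_0 l f : back (S l) f 0 = f l.
Proof. unfold back; simpl. f_equal; lia. Qed.

Lemma back_le l f p B :
  0 <= B -> ((p < l)%nat -> f (l - 1 - p)%nat <= B) -> back l f p <= B.
Proof. intros HB Hf; unfold back. destruct (Nat.ltb_spec p l); auto. Qed.

(** * Delayed descent *)

Section DelayedDescent.

(* [F S l] stands for the mean squared error after applying, among the first [l] updates, those
   in [S]; [G l] for the mean squared residual read at step [l]. *)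
Variables (H tau : nat) (beta rho q lo e0 : R) (K : nat -> nat -> bool).
Variables (F : (nat -> bool) -> nat -> R) (G : nat -> R).

Let all : nat -> bool := fun _ => true.
(** Here [1 - q] stands for smax^2 / n and [lo] for smin^2 / n, so that [lo / (1 - q) / 2] is 1 / (2
    kappa^2). *)
Let c := beta ^ 2 * INR tau * rho.
Let omega := 2 * beta * (1 - beta - rho * INR tau ^ 2 * beta / 2).
Let chi := rho * INR tau ^ 3 * beta ^ 2 * (1 - q) / q ^ (2 * tau).

Hypothesis Hbeta : 0 <= beta < 1.
Hypothesis Hrho : 0 <= rho.
Hypothesis Hq : 0 < q < 1.
Hypothesis Hlo : 0 < lo <= 1 - q.
Hypothesis Homega : 0 < omega.
Hypothesis HK : forall j i, (i + tau + 1 <= j)%nat -> K j i = true.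
Hypothesis F_0 : forall S, F S 0 = e0.
Hypothesis F_nonneg : forall S l, 0 <= F S l.
Hypothesis F_ext : forall S S' l, (forall k, (k < l)%nat -> S k = S' k) -> F S l = F S' l.
Hypothesis F_skip : forall T l, T l = false -> F T (S l) = F T l.
(** [H] is the length of the averaged sequences: the direction of step [l] is random only for
    [l < H]. *)
Hypothesis F_lower : forall T l, (l < H)%nat -> q * F T l <= F T (S l).
Hypothesis F_upper : forall T l, (l < H)%nat -> T l = true ->
  (forall k, (k + tau < l)%nat -> T k = K l k) ->
  F T (S l) <= F T l - 2 * beta * (1 - beta) * G l + c * sumR tau (back l G).
Hypothesis G_lower : forall l, (l < H)%nat -> lo * F (K l) l <= G l.
Hypothesis G_upper : forall l, (l < H)%nat -> G l <= (1 - q) * F (K l) l.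

Let V l := F all l + c * sumR tau (fun p => (INR tau - INR p) * back l G p).

Lemma c_nonneg : 0 <= c.
Proof.
  apply Rmult_le_pos; [|exact Hrho]. apply Rmult_le_pos; [apply pow2_ge_0 | apply pos_INR].
Qed.

Lemma chi_nonneg : 0 <= chi.
Proof.
  apply Rle_mult_inv_pos; [|apply pow_lt; lra].
  pose proof (pow_le (INR tau) 3 (pos_INR _)). pose proof (pow2_ge_0 beta).
  apply Rmult_le_pos; [apply Rmult_le_pos; [apply Rmult_le_pos|]|]; lra.
Qed.

Lemma G_nonneg l : (l < H)%nat -> 0 <= G l.
Proof.
  intros Hl. pose proof (G_lower l Hl). pose proof (F_nonneg (K l) l). nra.
Qed.

Lemma back_nonneg l p : (l <= H)%nat -> 0 <= back l G p.
Proof.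
  intros Hl; unfold back. destruct (Nat.ltb_spec p l); [apply G_nonneg; lia | lra].
Qed.

(* The weight [tau - p] of an update counts the future reads that can still miss it, so that each
   delay penalty is charged once to the update causing it. *)
Lemma V_step l : (l < H)%nat -> V (S l) <= V l - omega * G l.
Proof.
  intros Hl. unfold V.
  (* Passing to [l + 1] shifts the window: [G l] enters with weight [tau], each older weight drops
     by one, and the extra position [tau] has weight 0. *)
  assert (HW : sumR tau (fun p => (INR tau - INR p) * back (S l) G p)
     = INR tau * G l + sumR tau (fun p => (INR tau - INR p) * back l G p)
       - sumR tau (back l G)).
  { pose proof (sumR_S_head tau (fun p => (INR tau - INR p) * back (S l) G p)) as Hh.
    cbn [sumR] in Hh. rewrite back_succ_0 in Hh. simpl INR in Hh.
    rewrite (sumR_ext tau (fun i => (INR tau - INR (S i)) * _)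
      (fun i => (INR tau - INR i) * back l G i + (-1) * back l G i)) in Hh.
    - rewrite sumR_plus, sumR_scal in Hh. lra.
    - intros i _. rewrite back_succ_S, S_INR. ring. }
  rewrite HW.
  pose proof (F_upper all l Hl eq_refl
    (fun k Hk => eq_sym (HK l k ltac:(lia)))) as Hu.
  (* The released weights pay the penalty in [F_upper], and 2 beta (1 - beta) - c tau = omega. *)
  unfold omega, c in *. nra.
Qed.

Lemma V_descent s k : (s + k <= H)%nat ->
  V (s + k) <= V s - omega * sumR k (fun j => G (s + j)).
Proof.
  induction k as [|k IH]; intros Hk; [rewrite Nat.add_0_r; simpl; lra|].
  rewrite Nat.add_succ_r. cbn [sumR].
  pose proof (V_step (s + k) ltac:(lia)). specialize (IH ltac:(lia)). lra.
Qed.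

Lemma E_le_V l : (l <= H)%nat -> F all l <= V l.
Proof.
  intros Hl. unfold V.
  pose proof c_nonneg.
  assert (0 <= sumR tau (fun p => (INR tau - INR p) * back l G p)).
  { apply sumR_nonneg; intros p Hp. apply Rmult_le_pos; [|now apply back_nonneg].
    apply lt_INR in Hp; lra. }
  nra.
Qed.

Lemma F_lower_pow T l k : (l + k <= H)%nat -> q ^ k * F T l <= F T (l + k).
Proof.
  induction k as [|k IH]; intros Hk; [rewrite Nat.add_0_r; simpl; lra|].
  rewrite Nat.add_succ_r. simpl pow.
  pose proof (F_lower T (l + k) ltac:(lia)). specialize (IH ltac:(lia)). nra.
Qed.

Lemma F_lower_within T l i t : (l <= i <= H)%nat -> (i <= l + t)%nat ->
  q ^ t * F T l <= F T i.
Proof.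
  intros Hli Ht. replace i with (l + (i - l))%nat at 1 by lia.
  eapply Rle_trans; [|apply F_lower_pow; lia].
  apply Rmult_le_compat_r; [apply F_nonneg|]. apply pow_le_antitone; [lra|lia].
Qed.

Lemma F_K_prefix l s : (s + tau <= l)%nat -> F (K l) s = F all s.
Proof. intros Hs. apply F_ext. intros k Hk. apply HK; lia. Qed.

(** Read [s + d + j] keeps at least the fraction q^(d+j) of the energy at [s], so the residuals
    dominate a geometric series, whose sum is at least 1 / (2 (1 - q)). The offset [d] leaves time
    for all updates before [s] to become visible. *)
Lemma residual_sum s d k :
  (forall j, (j < k)%nat -> F (K (s + d + j)) s = F all s) ->
  (s + d + k <= H)%nat -> q ^ k <= 1 / 2 ->
  lo / (1 - q) / 2 * q ^ d * F all s <= sumR k (fun j => G (s + d + j)).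
Proof.
  intros Hpre Hk Hhalf.
  assert (Hs : lo * q ^ d * F all s * sumR k (fun j => q ^ j) <= sumR k (fun j => G (s + d + j))).
  { rewrite <- sumR_scal. apply sumR_le; intros j Hj.
    pose proof (G_lower (s + d + j) ltac:(lia)) as Hg.
    pose proof (F_lower_pow (K (s + d + j)) s (d + j) ltac:(lia)) as Hp.
    rewrite Nat.add_assoc, Hpre, pow_add in Hp by exact Hj.
    apply (Rmult_le_compat_l lo) in Hp; lra. }
  pose proof (sumR_geom k q) as Hgeo.
  assert (Hb : 1 / (1 - q) / 2 <= sumR k (fun j => q ^ j)).
  { apply (Rmult_le_reg_l (1 - q)); [lra|]. rewrite Hgeo.
    replace ((1 - q) * (1 / (1 - q) / 2)) with (1 / 2) by (field; lra). lra. }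
  eapply Rle_trans; [|exact Hs].
  replace (lo / (1 - q) / 2 * q ^ d * F all s)
    with (lo * q ^ d * F all s * (1 / (1 - q) / 2)) by (field; lra).
  apply Rmult_le_compat_l; [|exact Hb].
  pose proof (pow_lt q d (proj1 Hq)).
  apply Rmult_le_pos; [apply Rmult_le_pos; lra | apply F_nonneg].
Qed.

(** No penalty is pending at time 0, and no earlier update can be missed, so neither [chi] nor an
    offset is paid. *)
Lemma first_epoch m : (m <= H)%nat -> q ^ m <= 1 / 2 ->
  F all m <= (1 - omega * (lo / (1 - q) / 2)) * e0.
Proof.
  intros Hm Hhalf.
  pose proof (V_descent 0 m Hm) as Hd. pose proof (E_le_V m Hm) as Hv.
  pose proof (residual_sum 0 0 m) as Hr. simpl in Hr, Hd.
  rewrite !F_0 in Hr. specialize (Hr (fun j _ => F_0 _) Hm Hhalf).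
  assert (HV0 : V 0 = e0).
  { unfold V. rewrite F_0, sumR_zero; [ring|]. intros p _; unfold back; simpl; ring. }
  rewrite HV0 in Hd. apply (Rmult_le_compat_l omega) in Hr; lra.
Qed.

(* Adding the updates in [K i] one at a time to [x_(i - tau)], each of at most [tau] steps costs at
   most the delay penalty [c * tau * max G], and [max G] is again controlled by older stale reads. *)
Lemma stale_read_bound_large C : (2 <= tau)%nat -> 0 <= C -> 1 + chi * C <= C ->
  forall i, (i < H)%nat -> q ^ tau * F (K i) i <= C * F all i.
Proof.
  intros Ht HC HchiC i. induction i as [i IH] using lt_wf_ind. intros Hi.
  assert (Hqt : 0 < q ^ tau) by (apply pow_lt; lra).
  (* [B] bounds the residuals of the last [2 * tau] steps: an update at most [tau] steps old may
     itself have missed updates [tau] steps older. *)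
  set (B := (1 - q) * C * F all i / (q ^ tau * q ^ (2 * tau))).
  assert (Hq2t : 0 < q ^ (2 * tau)) by (apply pow_lt; lra).
  assert (HB0 : 0 <= B).
  { apply Rle_mult_inv_pos; [|apply Rmult_lt_0_compat; assumption].
    apply Rmult_le_pos; [apply Rmult_le_pos; lra | apply F_nonneg]. }
  assert (HB : forall k, (k < i)%nat -> (i <= k + 2 * tau)%nat -> G k <= B).
  { intros k Hk Hik. specialize (IH k Hk ltac:(lia)).
    pose proof (G_upper k ltac:(lia)) as Hg.
    pose proof (F_lower_within all k i (2 * tau) ltac:(lia) Hik) as Hw.
    unfold B. apply (Rmult_le_reg_l (q ^ tau * q ^ (2 * tau))); [nra|].
    replace (q ^ tau * q ^ (2 * tau) * ((1 - q) * C * F all i / (q ^ tau * q ^ (2 * tau))))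
      with ((1 - q) * C * F all i) by (field; lra).
    apply (Rmult_le_compat_l (q ^ tau * q ^ (2 * tau))) in Hg; [|nra].
    apply (Rmult_le_compat_l ((1 - q) * q ^ (2 * tau))) in IH; [|nra].
    apply (Rmult_le_compat_l ((1 - q) * C)) in Hw; [|apply Rmult_le_pos; lra].
    lra. }
  assert (Hpen : 0 <= c * (INR tau * B)).
  { apply Rmult_le_pos; [apply c_nonneg | apply Rmult_le_pos; [apply pos_INR | exact HB0]]. }
  (* If [i < tau], the truncated [i - tau] is 0 and the walk starts at x_0. *)
  assert (Hinc : forall d, (i - tau + d <= i)%nat ->
    F (K i) (i - tau + d) <= F (K i) (i - tau) + INR d * (c * (INR tau * B))).
  { pose proof c_nonneg as Hc.
    induction d as [|d IHd]; intros Hd; [rewrite Nat.add_0_r; simpl; lra|].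
    specialize (IHd ltac:(lia)). rewrite Nat.add_succ_r, S_INR.
    destruct (K i (i - tau + d)) eqn:HKid; [|rewrite F_skip by exact HKid; lra].
    set (l := (i - tau + d)%nat) in *.
    assert (Hagree : forall k, (k + tau < l)%nat -> K i k = K l k).
    { intros k Hk. rewrite !HK; [reflexivity | lia | lia]. }
    pose proof (F_upper (K i) l ltac:(lia) HKid Hagree) as Hu.
    assert (HU : sumR tau (back l G) <= INR tau * B).
    { rewrite <- sumR_const. apply sumR_le; intros p Hp. apply back_le; [exact HB0|].
      intros Hpl. apply HB; lia. }
    apply (Rmult_le_compat_l c) in HU; [|exact Hc].
    pose proof (G_nonneg l ltac:(lia)).
    assert (0 <= 2 * beta * (1 - beta) * G l).
    { apply Rmult_le_pos; [apply Rmult_le_pos|]; lra. }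
    lra. }
  specialize (Hinc (i - (i - tau))%nat ltac:(lia)).
  replace (i - tau + (i - (i - tau)))%nat with i in Hinc by lia.
  assert (Hpre : F (K i) (i - tau) = F all (i - tau)).
  { apply F_ext. intros k Hk. apply HK; lia. }
  rewrite Hpre in Hinc.
  pose proof (F_lower_within all (i - tau) i tau ltac:(lia) ltac:(lia)) as Hw.
  assert (Hd : INR (i - (i - tau)) * (c * (INR tau * B)) <= INR tau * (c * (INR tau * B))).
  { apply Rmult_le_compat_r; [exact Hpen|]. apply le_INR; lia. }
  (* The factor q^tau cancels the one lost in the induction hypothesis, leaving [chi * C]; then
     [1 + chi * C <= C] closes the induction. *)
  assert (Hchi : q ^ tau * (INR tau * (c * (INR tau * B))) = chi * C * F all i).
  { unfold B, c, chi. field. lra. }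
  pose proof (F_nonneg all i) as Hn.
  apply (Rmult_le_compat_l (q ^ tau)) in Hinc; [|lra].
  apply (Rmult_le_compat_l (q ^ tau)) in Hd; [|lra].
  apply (Rmult_le_compat_r (F all i)) in HchiC; [|lra].
  lra.
Qed.

(** Only the latest update can be missed, so the read is either the current iterate or the previous
    one, and the latter costs a single factor 1 / q. *)
Lemma stale_read_bound_1 : tau = 1%nat ->
  forall i, (i < H)%nat -> q ^ tau * F (K i) i <= F all i.
Proof.
  intros Ht [|i] Hi; rewrite Ht, pow_1.
  - rewrite !F_0. pose proof (F_nonneg all 0) as Hn. rewrite F_0 in Hn. nra.
  - destruct (K (S i) i) eqn:HKi.
    + rewrite (F_ext (K (S i)) all (S i)).
      * pose proof (F_nonneg all (S i)). nra.
      * intros k Hk. destruct (Nat.eq_dec k i) as [->|]; [exact HKi | apply HK; lia].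
    + rewrite F_skip, F_K_prefix by (exact HKi || lia). apply F_lower; lia.
Qed.

(* [C * tau * (tau + 1) / 2 <= tau ^ 2], because [tau * (tau + 1) / 2] pairs (missed update, later
   read) cross an epoch boundary while [chi] pays for [tau ^ 2] of them. *)
Lemma stale_read_bound : (1 <= tau)%nat -> chi <= 1 / 4 ->
  exists C, 0 <= C /\ C * (INR tau + 1) <= 2 * INR tau /\
    forall i, (i < H)%nat -> q ^ tau * F (K i) i <= C * F all i.
Proof.
  intros Ht Hchi. destruct (Nat.eq_dec tau 1) as [H1|H1].
  - exists 1. split; [lra|]. split; [rewrite H1; simpl; lra|].
    intros i Hi. rewrite Rmult_1_l. now apply stale_read_bound_1.
  (* 4/3 solves 1 + C / 4 = C, and 4/3 (tau + 1) <= 2 tau holds from [tau = 2] on. *)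
  - exists (4 / 3). split; [lra|]. split.
    + assert (Ht2 : (2 <= tau)%nat) by lia. apply le_INR in Ht2. simpl in Ht2. lra.
    + apply stale_read_bound_large; [lia | lra | lra].
Qed.

(** Each of the last [tau] residuals is at most [B], and the weights add up to tau (tau + 1) / 2;
    the bound on [C] turns their product into the tau^2 that [chi] provides for. *)
Lemma V_le s : (s <= H)%nat -> chi <= 1 / 4 -> V s <= (1 + chi) * F all s.
Proof.
  intros Hs Hchi. unfold V.
  destruct (Nat.eq_dec tau 0) as [H0|H0].
  { pose proof chi_nonneg. pose proof (F_nonneg all s).
    rewrite sumR_zero by (intros; lia). nra. }
  destruct (stale_read_bound ltac:(lia) Hchi) as (C & HC & HCt & HM).
  assert (Hqt : 0 < q ^ tau) by (apply pow_lt; lra).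
  pose proof (F_nonneg all s) as Hn.
  set (B := (1 - q) * C * F all s / q ^ (2 * tau)).
  assert (Hq2 : q ^ (2 * tau) = q ^ tau * q ^ tau) by (rewrite <- pow_add; f_equal; lia).
  assert (HB0 : 0 <= B).
  { apply Rle_mult_inv_pos; [|rewrite Hq2; apply Rmult_lt_0_compat; assumption].
    apply Rmult_le_pos; [apply Rmult_le_pos; lra | exact Hn]. }
  assert (HW : sumR tau (fun p => (INR tau - INR p) * back s G p)
               <= B * sumR tau (fun p => INR tau - INR p)).
  { rewrite <- sumR_scal. apply sumR_le; intros p Hp. rewrite (Rmult_comm B).
    apply Rmult_le_compat_l; [apply lt_INR in Hp; lra|].
    apply back_le; [exact HB0|]. intros Hps. set (k := (s - 1 - p)%nat).
    pose proof (G_upper k ltac:(lia)) as Hg. pose proof (HM k ltac:(lia)) as Hm.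
    pose proof (F_lower_within all k s tau ltac:(lia) ltac:(lia)) as Hw.
    unfold B. rewrite Hq2. apply (Rmult_le_reg_l (q ^ tau * q ^ tau)); [nra|].
    replace (q ^ tau * q ^ tau * ((1 - q) * C * F all s / (q ^ tau * q ^ tau)))
      with ((1 - q) * C * F all s) by (field; lra).
    apply (Rmult_le_compat_l (q ^ tau * q ^ tau)) in Hg; [|nra].
    apply (Rmult_le_compat_l ((1 - q) * q ^ tau)) in Hm; [|nra].
    apply (Rmult_le_compat_l ((1 - q) * C)) in Hw; [|apply Rmult_le_pos; lra].
    lra. }
  pose proof (sumR_id tau) as Hid.
  assert (Hchi' : c * ((1 - q) * F all s / q ^ (2 * tau) * INR tau ^ 2) = chi * F all s).
  { unfold c, chi. field. rewrite Hq2. nra. }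
  assert (HBt : B * sumR tau (fun p => INR tau - INR p)
                <= (1 - q) * F all s / q ^ (2 * tau) * INR tau ^ 2).
  { set (D := (1 - q) * F all s / q ^ (2 * tau)).
    assert (HD : 0 <= D).
    { apply Rle_mult_inv_pos; [|rewrite Hq2; apply Rmult_lt_0_compat; assumption].
      apply Rmult_le_pos; [lra | exact Hn]. }
    replace B with (D * C) by (unfold B, D; field; rewrite Hq2; nra).
    rewrite Rmult_assoc. apply Rmult_le_compat_l; [exact HD|].
    apply (Rmult_le_compat_r (INR tau)) in HCt; [|apply pos_INR].
    apply (f_equal (Rmult C)) in Hid. lra. }
  pose proof c_nonneg as Hc.
  apply (Rmult_le_compat_l c) in HW; [|exact Hc].
  apply (Rmult_le_compat_l c) in HBt; [|exact Hc].
  lra.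
Qed.

(** During the first [tau] steps [V] merely does not grow. From then on every read contains all
    updates before [s], and at least [T0] steps remain to collect residuals. *)
Lemma next_epoch s T0 m : (s + (T0 + tau) <= m <= H)%nat -> q ^ T0 <= 1 / 2 -> chi <= 1 / 4 ->
  F all m <= (1 - omega * q ^ tau * (lo / (1 - q) / 2) + chi) * F all s.
Proof.
  intros Hm Hhalf Hchi. set (k := (m - (s + tau))%nat).
  assert (Hk : q ^ k <= 1 / 2).
  { eapply Rle_trans; [apply (pow_le_antitone q T0 k); [lra|lia] | exact Hhalf]. }
  pose proof (residual_sum s tau k) as Hr.
  specialize (Hr ltac:(intros; apply F_K_prefix; lia) ltac:(lia) Hk).
  pose proof (V_descent (s + tau) k ltac:(lia)) as Hd.
  replace (s + tau + k)%nat with m in Hd by lia.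
  pose proof (E_le_V m ltac:(lia)). pose proof (V_le s ltac:(lia) Hchi).
  pose proof (V_descent s tau ltac:(lia)) as Hd0.
  assert (0 <= omega * sumR tau (fun j => G (s + j))).
  { apply Rmult_le_pos; [lra|]. apply sumR_nonneg; intros; apply G_nonneg; lia. }
  apply (Rmult_le_compat_l omega) in Hr; lra.
Qed.

(** The delay term only lowers [omega], and 2 beta (1 - beta) peaks at 1/2. Hence a [chi] below the
    gain of an epoch is below 1/4. *)
Lemma omega_bounds : 0 < omega <= 1 / 2.
Proof.
  split; [exact Homega|]. unfold omega.
  assert (0 <= beta * (rho * INR tau ^ 2 * beta)).
  { pose proof (pow2_ge_0 (INR tau)).
    apply Rmult_le_pos; [|apply Rmult_le_pos; [apply Rmult_le_pos|]]; lra. }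
  pose proof (pow2_ge_0 (beta - 1 / 2)). lra.
Qed.

Lemma all_epochs T0 r m : q ^ T0 <= 1 / 2 -> (1 <= r)%nat -> (r * (T0 + tau) <= m <= H)%nat ->
  F all m <= (1 - omega * (lo / (1 - q) / 2))
             * (1 - omega * q ^ tau * (lo / (1 - q) / 2) + chi) ^ (r - 1) * e0.
Proof.
  intros Hhalf Hr Hm.
  pose proof omega_bounds as Hom. pose proof chi_nonneg as Hchi0.
  assert (He0 : 0 <= e0) by (rewrite <- (F_0 all); apply F_nonneg).
  set (k2 := lo / (1 - q) / 2).
  assert (Hk2 : 0 <= k2 <= 1 / 2).
  { unfold k2. assert (0 <= lo / (1 - q) <= 1); [|lra]. split.
    - unfold Rdiv; apply Rmult_le_pos; [lra | left; apply Rinv_0_lt_compat; lra].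
    - apply (Rmult_le_reg_r (1 - q)); [lra|]. field_simplify; lra. }
  assert (Hqt : 0 < q ^ tau <= 1).
  { split; [apply pow_lt; lra|]. apply (pow_le_antitone q 0 tau); [lra|lia]. }
  assert (Hdelta : 0 <= omega * q ^ tau * k2 <= 1 / 4).
  { assert (0 <= omega * q ^ tau <= 1 / 2) by nra. nra. }
  assert (Hfirst : forall m, (T0 <= m <= H)%nat -> F all m <= (1 - omega * k2) * e0).
  { intros m' Hm'. apply first_epoch; [lia|].
    eapply Rle_trans; [apply (pow_le_antitone q T0 m'); [lra|lia] | exact Hhalf]. }
  assert (Hpre : 0 <= (1 - omega * k2) * e0) by (apply Rmult_le_pos; nra).
  destruct (Rle_lt_dec (omega * q ^ tau * k2) chi) as [Hbig|Hsmall].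
  - pose proof (pow_R1_Rle (1 - omega * q ^ tau * k2 + chi) (r - 1) ltac:(lra)) as Hp.
    assert (F all m <= (1 - omega * k2) * e0) by (apply Hfirst; nia).
    nra.
  - destruct r as [|r]; [lia|]. simpl Nat.sub. rewrite Nat.sub_0_r. clear Hr.
    revert m Hm. induction r as [|r IH]; intros m Hm.
    + simpl pow. rewrite Rmult_1_r. apply Hfirst; lia.
    (* The last epoch is taken to be the final [T0 + tau] steps before [m], so the induction
       hypothesis applies at its start. *)
    + pose proof (next_epoch (m - (T0 + tau)) T0 m ltac:(lia) Hhalf ltac:(lra)) as Hn.
      specialize (IH (m - (T0 + tau))%nat ltac:(lia)).
      fold k2 in Hn. simpl pow.
      apply (Rmult_le_compat_l (1 - omega * q ^ tau * k2 + chi)) in IH; lra.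
Qed.

End DelayedDescent.

(** * The least-squares energy *)

Lemma gram_sym N A l r : gram N A l r = gram N A r l.
Proof. apply sumR_ext; intros; ring. Qed.

Lemma matvec_gram N n A y c :
  matvec n (gram N A) y c = sumR N (fun i => A i c * matvec n A y i).
Proof.
  unfold matvec, gram.
  rewrite (sumR_ext n _ (fun j => sumR N (fun i => A i c * (A i j * y j)))).
  - rewrite sumR_swap. apply sumR_ext; intros. now rewrite sumR_scal.
  - intros j _. rewrite Rmult_comm, <- sumR_scal. apply sumR_ext; intros; ring.
Qed.

Lemma sum_mul_matvec_gram N n A u y :
  sumR n (fun c => u c * matvec n (gram N A) y c)
  = sumR N (fun i => matvec n A u i * matvec n A y i).
Proof.
  rewrite (sumR_ext n _ (fun c => sumR N (fun i => A i c * u c * matvec n A y i))).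
  - rewrite sumR_swap. apply sumR_ext; intros i _. rewrite Rmult_comm.
    unfold matvec at 3. rewrite <- sumR_scal. apply sumR_ext; intros; ring.
  - intros c _. rewrite matvec_gram, <- sumR_scal. apply sumR_ext; intros; ring.
Qed.

Lemma normX_sqnorm N n A v : normX N n A v = sqnorm N (matvec n A v).
Proof.
  unfold normX, sqnorm. rewrite <- sum_mul_matvec_gram.
  apply sumR_ext; intros l _. unfold matvec. rewrite <- sumR_scal.
  apply sumR_ext; intros; ring.
Qed.

Lemma sqnorm_nonneg k v : 0 <= sqnorm k v.
Proof. apply sumR_nonneg; intros; nra. Qed.

Lemma matvec_line n B y t c i : (c < n)%nat ->
  matvec n B (fun l => y l + t * e_ c l) i = matvec n B y i + t * B i c.
Proof.
  intros Hc. unfold matvec.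
  rewrite (sumR_ext n _ (fun j => B i j * y j + t * (B i j * e_ c j))) by (intros; ring).
  now rewrite sumR_plus, sumR_scal, sumR_e.
Qed.

Lemma sqnorm_line N (A : nat -> nat -> R) u t c :
  sqnorm N (fun i => u i + t * A i c)
  = sqnorm N u + 2 * t * sumR N (fun i => A i c * u i) + t ^ 2 * gram N A c c.
Proof.
  unfold sqnorm, gram. rewrite <- !sumR_scal, <- !sumR_plus.
  apply sumR_ext; intros; ring.
Qed.

Lemma normX_line N n A y t c : (c < n)%nat ->
  normX N n A (fun l => y l + t * e_ c l)
  = normX N n A y + 2 * t * matvec n (gram N A) y c + t ^ 2 * gram N A c c.
Proof.
  intros Hc. rewrite !normX_sqnorm, matvec_gram, <- sqnorm_line.
  f_equal. apply functional_extensionality; intros i. now apply matvec_line.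
Qed.

Lemma weighted_cauchy k u v t : 0 < t ->
  2 * sumR k (fun i => u i * v i) <= / t * sqnorm k u + t * sqnorm k v.
Proof.
  intros Ht. unfold sqnorm. rewrite <- !sumR_scal, <- sumR_plus.
  apply sumR_le; intros i _.
  assert (Hsq : 0 <= / t * (u i - t * v i) ^ 2).
  { apply Rmult_le_pos; [left; now apply Rinv_0_lt_compat | apply pow2_ge_0]. }
  replace (/ t * (u i - t * v i) ^ 2) with
    (/ t * (u i * u i) + t * (v i * v i) - 2 * (u i * v i)) in Hsq by (field; lra).
  lra.
Qed.

(** With z = X y, |z|^2 is the inner product of A z and A y. Young's inequality with weight [a]
    gives 2 |z|^2 <= |A z|^2 / a + a |A y|^2, and the hypothesis absorbs one |z|^2, without
    diagonalising X. *)
Lemma sqnorm_gram_le N n A a y : 0 < a ->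
  (forall x, sqnorm N (matvec n A x) <= a * sqnorm n x) ->
  sqnorm n (matvec n (gram N A) y) <= a * normX N n A y.
Proof.
  intros Ha Hub. set (z := matvec n (gram N A) y).
  pose proof (weighted_cauchy N (matvec n A z) (matvec n A y) a Ha) as Hc.
  rewrite <- sum_mul_matvec_gram in Hc. fold z in Hc.
  change (sumR n (fun c => z c * z c)) with (sqnorm n z) in Hc.
  rewrite <- (normX_sqnorm N n A y) in Hc.
  pose proof (Rmult_le_compat_l (/ a) _ _ (Rlt_le _ _ (Rinv_0_lt_compat a Ha)) (Hub z)) as Hz.
  rewrite <- Rmult_assoc, Rinv_l, Rmult_1_l in Hz by lra. lra.
Qed.

(** Dually, |A y|^2 is the inner product of y and z = X y, and Young's term a |y|^2 is absorbed by
    |A y|^2. *)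
Lemma sqnorm_gram_ge N n A a y : 0 < a ->
  (forall x, a * sqnorm n x <= sqnorm N (matvec n A x)) ->
  a * normX N n A y <= sqnorm n (matvec n (gram N A) y).
Proof.
  intros Ha Hlb. set (z := matvec n (gram N A) y).
  pose proof (weighted_cauchy n z y a Ha) as Hc.
  rewrite (sumR_ext n _ (fun c => y c * z c)) in Hc by (intros; ring).
  unfold z at 1 in Hc. rewrite sum_mul_matvec_gram in Hc.
  change (sumR N _) with (sqnorm N (matvec n A y)) in Hc.
  specialize (Hlb y). rewrite <- (normX_sqnorm N n A y) in Hc, Hlb.
  assert (Hz : normX N n A y <= / a * sqnorm n z) by lra.
  apply (Rmult_le_compat_l a) in Hz; [|lra].
  rewrite <- Rmult_assoc, Rinv_r, Rmult_1_l in Hz by lra. exact Hz.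
Qed.

(** Moving by [- g] along [e_ c] lowers the objective by g^2, since the column has unit norm;
    minimality forces g = 0. *)
Lemma normal_equations N n A b xstar c :
  (c < n)%nat -> gram N A c c = 1 ->
  (forall x, sqnorm N (fun i => matvec n A xstar i - b i)
             <= sqnorm N (fun i => matvec n A x i - b i)) ->
  sumR N (fun i => A i c * (matvec n A xstar i - b i)) = 0.
Proof.
  intros Hc Hcc Hmin.
  set (g := sumR N (fun i => A i c * (matvec n A xstar i - b i))).
  specialize (Hmin (fun l => xstar l + (- g) * e_ c l)).
  replace (fun i => matvec n A (fun l => xstar l + - g * e_ c l) i - b i)
    with (fun i => (matvec n A xstar i - b i) + (- g) * A i c) in Hmin.
  - rewrite sqnorm_line, Hcc in Hmin. fold g in Hmin. nra.
  - apply functional_extensionality; intros i. rewrite matvec_line by exact Hc. ring.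
Qed.

(** * The asynchronous iteration *)

Section Iteration.

Variables (N n : nat) (A : nat -> nat -> R) (b xstar x0 : nat -> R) (beta : R).
Variable (K : nat -> nat -> bool).

Let gam s j := gamma N n A b x0 beta K s j.

(* Error after applying, among the first [l] updates, only those in [T]; both the iterates and the
   stale reads [x_K(j)] have this form. *)
Definition partial_error (T : nat -> bool) (l : nat) (s : nat -> nat) : nat -> R :=
  fun a => x0 a - xstar a + sumR l (fun k => if T k then beta * gam s k * e_ (s k) a else 0).

Lemma partial_error_succ T l s : T l = true ->
  partial_error T (S l) s
  = fun a => partial_error T l s a + beta * gam s l * e_ (s l) a.
Proof.
  intros HT. apply functional_extensionality; intros a. unfold partial_error.
  cbn [sumR]. rewrite HT. ring.
Qed.

Lemma partial_error_skip T l s : T l = false ->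
  partial_error T (S l) s = partial_error T l s.
Proof.
  intros HT. apply functional_extensionality; intros a. unfold partial_error.
  cbn [sumR]. rewrite HT. ring.
Qed.

Lemma partial_error_ext T T' l s : (forall k, (k < l)%nat -> T k = T' k) ->
  partial_error T l s = partial_error T' l s.
Proof.
  intros HT. apply functional_extensionality; intros a. unfold partial_error. f_equal.
  apply sumR_ext; intros k Hk. now rewrite HT.
Qed.

Lemma partial_error_all m s :
  partial_error (fun _ => true) m s = fun a => iterate N n A b x0 beta K s m a - xstar a.
Proof.
  apply functional_extensionality; intros a. unfold partial_error, iterate, gam. ring.
Qed.

Lemma gam_upto_lt s k i : (i < k)%nat -> gam_upto N n A b x0 beta K s k i = gam s i.
Proof.
  induction k as [|k IH]; intros Hi; [lia|].
  destruct (Nat.eq_dec i k) as [->|Hne]; [reflexivity|].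
  rewrite <- IH by lia. simpl. destruct (Nat.ltb_spec i k); [reflexivity|lia].
Qed.

(** Adaptedness: residuals before step [l] are computed before direction [l] is drawn, so redrawing
    it leaves them alone. *)
Lemma gam_upto_upd s l c k : (k <= l)%nat ->
  gam_upto N n A b x0 beta K (upd s l c) k = gam_upto N n A b x0 beta K s k.
Proof.
  induction k as [|k IH]; intros Hk; [reflexivity|]. simpl. rewrite IH by lia.
  assert (Hs : forall i, (i <= k)%nat -> upd s l c i = s i).
  { intros i Hi; unfold upd. destruct (Nat.eqb_spec i l); [lia|reflexivity]. }
  rewrite Hs by lia.
  replace (fun a => x0 a + sumR k (fun i => if K k i
     then beta * gam_upto N n A b x0 beta K s k i * e_ (upd s l c i) a else 0))
    with (fun a => x0 a + sumR k (fun i => if K k i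
     then beta * gam_upto N n A b x0 beta K s k i * e_ (s i) a else 0)); [reflexivity|].
  apply functional_extensionality; intros a. f_equal. apply sumR_ext; intros i Hi.
  now rewrite Hs by lia.
Qed.

Lemma gam_upd s l c j : (j < l)%nat -> gam (upd s l c) j = gam s j.
Proof. intros Hj. unfold gam, gamma. now rewrite gam_upto_upd by lia. Qed.

Lemma partial_error_upd T s l c k : (k <= l)%nat ->
  partial_error T k (upd s l c) = partial_error T k s.
Proof.
  intros Hk. apply functional_extensionality; intros a. unfold partial_error. f_equal.
  apply sumR_ext; intros i Hi. rewrite gam_upd by lia.
  unfold upd. destruct (Nat.eqb_spec i l); [lia|reflexivity].
Qed.

Lemma matvec_partial_error B i T l s : (forall k, (s k < n)%nat) ->
  matvec n B (partial_error T l s) i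
  = matvec n B (fun a => x0 a - xstar a) i
    + sumR l (fun k => if T k then beta * gam s k * B i (s k) else 0).
Proof.
  intros Hs. induction l as [|l IH].
  - simpl. rewrite Rplus_0_r. f_equal. apply functional_extensionality; intros a.
    unfold partial_error; simpl; ring.
  - cbn [sumR]. destruct (T l) eqn:HT.
    + rewrite partial_error_succ, matvec_line, IH by auto. ring.
    + rewrite partial_error_skip, IH by auto. ring.
Qed.

Hypothesis Hunit : forall c, (c < n)%nat -> gram N A c c = 1.
Hypothesis Hmin : forall x, sqnorm N (fun i => matvec n A xstar i - b i)
                            <= sqnorm N (fun i => matvec n A x i - b i).

(** The normal equations replace A^T b by X x*, making [gamma] minus a coordinate of X times the
    stale error. *)
Lemma gam_residual s j : (s j < n)%nat ->
  gam s j = - matvec n (gram N A) (partial_error (K j) j s) (s j).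
Proof.
  intros Hs. unfold gam, gamma. simpl gam_upto. rewrite Nat.ltb_irrefl, Nat.eqb_refl.
  pose proof (normal_equations N n A b xstar (s j) Hs (Hunit _ Hs) Hmin) as Hne.
  rewrite matvec_gram.
  replace (fun l => x0 l + _) with (fun l => partial_error (K j) j s l + xstar l).
  - rewrite (sumR_ext N _ (fun i => (-1) * (A i (s j) * (matvec n A xstar i - b i))
      + (-1) * (A i (s j) * matvec n A (partial_error (K j) j s) i))).
    + rewrite sumR_plus, !sumR_scal, Hne. ring.
    + intros i _.
      replace (matvec n A (fun l => partial_error (K j) j s l + xstar l) i)
        with (matvec n A (partial_error (K j) j s) i + matvec n A xstar i); [ring|].
      unfold matvec. rewrite <- sumR_plus. apply sumR_ext; intros; ring.
  - apply functional_extensionality; intros a. unfold partial_error.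
    rewrite (sumR_ext j (fun i => if K j i then beta * gam_upto _ _ _ _ _ _ _ _ _ _ * _ else 0)
       (fun k => if K j k then beta * gam s k * e_ (s k) a else 0)); [ring|].
    intros k Hk. now rewrite gam_upto_lt.
Qed.

(* The exact line search along [e^(s l)] decreases the energy most, whatever the step taken. *)
Lemma partial_error_lower T l s : (s l < n)%nat ->
  normX N n A (partial_error T l s) - matvec n (gram N A) (partial_error T l s) (s l) ^ 2
  <= normX N n A (partial_error T (S l) s).
Proof.
  intros Hs. destruct (T l) eqn:HT.
  - rewrite partial_error_succ, normX_line, Hunit by auto.
    pose proof (pow2_ge_0 (matvec n (gram N A) (partial_error T l s) (s l) + beta * gam s l)). lra.
  - rewrite partial_error_skip by exact HT.
    pose proof (pow2_ge_0 (matvec n (gram N A) (partial_error T l s) (s l))). lra.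
Qed.

(** The slope at the current error is - gamma + beta Q, where Q collects the updates on which [T]
    and the read disagree. Bounding 2 gamma Q by gamma^2 + Q^2 and Q^2 by Cauchy-Schwarz over [tau]
    terms gives the claim. *)
Lemma partial_error_upper tau T l s : (forall k, (s k < n)%nat) -> T l = true ->
  (forall k, (k + tau < l)%nat -> T k = K l k) ->
  normX N n A (partial_error T (S l) s)
  <= normX N n A (partial_error T l s) - 2 * beta * (1 - beta) * gam s l ^ 2
     + beta ^ 2 * INR tau
       * sumR tau (back l (fun k => gam s k ^ 2 * gram N A (s l) (s k) ^ 2)).
Proof.
  intros Hs HT Hagree. rewrite partial_error_succ, normX_line, Hunit by auto.
  (* The sign is +1 for an update the read missed, -1 for one only the read contains, and 0 on
     agreement. *)
  set (w := fun k => ((if T k then 1 else 0) - (if K l k then 1 else 0))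
                     * gam s k * gram N A (s l) (s k)).
  assert (HQ : matvec n (gram N A) (partial_error T l s) (s l)
               = - gam s l + beta * sumR tau (back l w)).
  { rewrite gam_residual, !matvec_partial_error by auto.
    rewrite <- sumR_window.
    - rewrite <- sumR_scal.
      rewrite (sumR_ext l (fun k => if T k then _ else 0) (fun k => beta * w k
        + (if K l k then beta * gam s k * gram N A (s l) (s k) else 0))).
      + rewrite sumR_plus. ring.
      + intros k _. unfold w. destruct (T k), (K l k); ring.
    - intros k Hk. unfold w. rewrite Hagree by exact Hk. ring. }
  rewrite HQ. set (Q := sumR tau (back l w)).
  assert (HQ2 : Q ^ 2 <= INR tau
      * sumR tau (back l (fun k => gam s k ^ 2 * gram N A (s l) (s k) ^ 2))).
  { eapply Rle_trans; [apply sumR_sqr_le|].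
    apply Rmult_le_compat_l; [apply pos_INR|]. apply sumR_le; intros p _.
    unfold back. destruct (Nat.ltb p l); [|lra]. unfold w.
    set (z := gam s _). set (x := gram _ _ _ _).
    pose proof (pow2_ge_0 (z * x)). destruct (T (l - 1 - p)%nat), (K l (l - 1 - p)%nat); lra. }
  apply (Rmult_le_compat_l (beta ^ 2)) in HQ2; [|apply pow2_ge_0].
  pose proof (pow2_ge_0 (beta * gam s l - beta * Q)). lra.
Qed.

(** * Mean energies and residuals *)

Variables (H : nat) (rho2 : R).
Hypothesis Hn : (0 < n)%nat.
Hypothesis Hrho : forall l, (l < n)%nat -> / INR n * sumR n (fun r => gram N A l r ^ 2) <= rho2.

Let F T l := expect n H (fun s => normX N n A (partial_error T l s)).
Let G l := expect n H (fun s => gam s l ^ 2).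

Lemma upd_same s l c : upd s l c l = c.
Proof. unfold upd. now rewrite Nat.eqb_refl. Qed.

Lemma upd_other s l c k : k <> l -> upd s l c k = s k.
Proof. intros Hk; unfold upd. destruct (Nat.eqb_spec k l); [contradiction|reflexivity]. Qed.

(** The partial error at [l] is independent of [s l], so averaging over [s l] turns one squared
    coordinate into the squared norm over [n]. *)
Lemma expect_residual T l : (l < H)%nat ->
  expect n H (fun s => matvec n (gram N A) (partial_error T l s) (s l) ^ 2)
  = / INR n * expect n H (fun s => sqnorm n (matvec n (gram N A) (partial_error T l s))).
Proof.
  intros Hl. rewrite (expect_resample n H l) by assumption. rewrite <- expect_scal.
  apply expect_ext; [exact Hn|]. intros s Hs. f_equal. apply sumR_ext; intros c Hc.
  rewrite partial_error_upd, upd_same by lia. ring.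
Qed.

Lemma expect_lower a T l : 0 < a -> (l < H)%nat ->
  (forall x, sqnorm N (matvec n A x) <= a * sqnorm n x) ->
  (1 - a / INR n) * F T l <= F T (S l).
Proof.
  intros Ha Hl Hub. unfold F.
  apply Rle_trans with (expect n H (fun s => normX N n A (partial_error T l s)
     + (-1) * matvec n (gram N A) (partial_error T l s) (s l) ^ 2)).
  - rewrite expect_plus, expect_scal, expect_residual by exact Hl.
    assert (Hs : expect n H (fun s => sqnorm n (matvec n (gram N A) (partial_error T l s)))
                 <= a * expect n H (fun s => normX N n A (partial_error T l s))).
    { rewrite <- expect_scal. apply expect_le; [exact Hn|]. intros; now apply sqnorm_gram_le. }
    apply (Rmult_le_compat_l (/ INR n)) in Hs; [|left; apply Rinv_0_lt_compat, lt_0_INR; lia].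
    unfold Rdiv. lra.
  - apply expect_le; [exact Hn|]. intros s Hs. pose proof (partial_error_lower T l s (Hs l)). lra.
Qed.

Lemma expect_gam l : (l < H)%nat ->
  G l = / INR n * expect n H (fun s => sqnorm n (matvec n (gram N A) (partial_error (K l) l s))).
Proof.
  intros Hl. rewrite <- expect_residual by exact Hl. apply expect_ext; [exact Hn|].
  intros s Hs. rewrite gam_residual by auto. ring.
Qed.

Lemma expect_gam_le a l : 0 < a -> (l < H)%nat ->
  (forall x, sqnorm N (matvec n A x) <= a * sqnorm n x) -> G l <= a / INR n * F (K l) l.
Proof.
  intros Ha Hl Hub. rewrite expect_gam by exact Hl. unfold Rdiv, F.
  rewrite (Rmult_comm a), Rmult_assoc, <- (expect_scal n H a).
  apply Rmult_le_compat_l; [left; apply Rinv_0_lt_compat, lt_0_INR; lia|].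
  apply expect_le; [exact Hn|]. intros; now apply sqnorm_gram_le.
Qed.

Lemma expect_gam_ge a l : 0 < a -> (l < H)%nat ->
  (forall x, a * sqnorm n x <= sqnorm N (matvec n A x)) -> a / INR n * F (K l) l <= G l.
Proof.
  intros Ha Hl Hlb. rewrite expect_gam by exact Hl. unfold Rdiv, F.
  rewrite (Rmult_comm a), Rmult_assoc, <- (expect_scal n H a).
  apply Rmult_le_compat_l; [left; apply Rinv_0_lt_compat, lt_0_INR; lia|].
  apply expect_le; [exact Hn|]. intros; now apply sqnorm_gram_ge.
Qed.

(* [gam s k] does not depend on the later choice [s l], over which [X_(s l)(s k)^2] averages to at
   most [rho2]. *)
Lemma expect_gam_gram k l : (k < l < H)%nat ->
  expect n H (fun s => gam s k ^ 2 * gram N A (s l) (s k) ^ 2) <= rho2 * G k.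
Proof.
  intros Hkl. rewrite (expect_resample n H l) by lia. unfold G. rewrite <- expect_scal.
  apply expect_le; [exact Hn|]. intros s Hs.
  rewrite (sumR_ext n _ (fun c => gam s k ^ 2 * gram N A (s k) c ^ 2)).
  - rewrite sumR_scal. specialize (Hrho (s k) (Hs k)). pose proof (pow2_ge_0 (gam s k)). nra.
  - intros c Hc. rewrite gam_upd, upd_same, upd_other, gram_sym by lia. reflexivity.
Qed.

Lemma expect_upper tau T l : (l < H)%nat -> T l = true ->
  (forall k, (k + tau < l)%nat -> T k = K l k) ->
  F T (S l) <= F T l - 2 * beta * (1 - beta) * G l
               + beta ^ 2 * INR tau * rho2 * sumR tau (back l G).
Proof.
  intros Hl HT Hagree.
  assert (Hu : F T (S l) <= F T l + (- (2 * beta * (1 - beta)) * G l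
     + beta ^ 2 * INR tau * sumR tau (fun p => expect n H (fun s =>
         back l (fun k => gam s k ^ 2 * gram N A (s l) (s k) ^ 2) p)))).
  { unfold F, G. rewrite <- expect_sum, <- !expect_scal, <- !expect_plus by exact Hn.
    apply expect_le; [exact Hn|]. intros s Hs.
    eapply Rle_trans; [apply (partial_error_upper tau T l s Hs HT Hagree)|].
    right. unfold Rminus. rewrite Rplus_assoc. f_equal. f_equal. ring. }
  assert (Hw : sumR tau (fun p => expect n H (fun s =>
         back l (fun k => gam s k ^ 2 * gram N A (s l) (s k) ^ 2) p))
       <= rho2 * sumR tau (back l G)).
  { rewrite <- sumR_scal. apply sumR_le; intros p _. unfold back.
    destruct (Nat.ltb_spec p l); [apply expect_gam_gram; lia|].
    rewrite expect_const by exact Hn. lra. }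
  apply (Rmult_le_compat_l (beta ^ 2 * INR tau)) in Hw;
    [|apply Rmult_le_pos; [apply pow2_ge_0 | apply pos_INR]].
  lra.
Qed.

End Iteration.

(** * Singular value bounds and epoch length *)

Lemma sumR_eq_0 k f i :
  (forall j, (j < k)%nat -> 0 <= f j) -> sumR k f <= 0 -> (i < k)%nat -> f i = 0.
Proof.
  induction k as [|k IH]; intros Hf Hs Hi; [lia|]. cbn [sumR] in Hs.
  assert (0 <= sumR k f) by (apply sumR_nonneg; intros; apply Hf; lia).
  pose proof (Hf k ltac:(lia)).
  destruct (Nat.eq_dec i k) as [->|]; [lra|].
  apply IH; [intros; apply Hf; lia | lra | lia].
Qed.

(** The exact defect in Cauchy-Schwarz, used below to exploit its equality case. *)
Lemma sumR_variance k v : (0 < k)%nat ->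
  INR k * sumR k (fun j => v j ^ 2) - sumR k v ^ 2
  = INR k * sumR k (fun j => (v j - sumR k v / INR k) ^ 2).
Proof.
  intros Hk. assert (INR k <> 0) by (apply not_0_INR; lia).
  set (m := sumR k v / INR k).
  rewrite (sumR_ext k (fun j => (v j - m) ^ 2)
    (fun j => v j ^ 2 + ((-2 * m) * v j + m ^ 2))) by (intros; ring).
  rewrite !sumR_plus, sumR_scal, sumR_const. unfold m. field. assumption.
Qed.

Lemma matvec_basis n B c i : (c < n)%nat -> matvec n B (e_ c) i = B i c.
Proof. apply sumR_e. Qed.

Lemma sqnorm_basis n c : (c < n)%nat -> sqnorm n (e_ c) = 1.
Proof.
  intros Hc. unfold sqnorm. rewrite sumR_e by exact Hc. unfold e_. now rewrite Nat.eqb_refl.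
Qed.

(* Equality in [|A x|^2 <= n |x|^2] forces the vectors [x_j a_j] to coincide, against the linear
   independence of the columns [a_j] when [n >= 2]. *)
Lemma operator_norm_lt N n A x : (2 <= n)%nat ->
  (forall y, (forall i, (i < N)%nat -> matvec n A y i = 0) -> forall j, (j < n)%nat -> y j = 0) ->
  (forall j, (j < n)%nat -> sqnorm N (fun i => A i j) = 1) ->
  (exists j, (j < n)%nat /\ x j <> 0) ->
  sqnorm N (matvec n A x) < INR n * sqnorm n x.
Proof.
  intros Hn Hrank Hcol (j & Hj & Hxj). apply Rnot_le_lt. intros Hle. apply Hxj.
  set (v := fun i a => A i a * x a).
  set (dev := fun i => sumR n (fun a => (v i a - sumR n (v i) / INR n) ^ 2)).
  assert (Hnpos : 0 < INR n) by (apply lt_0_INR; lia).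
  assert (Hdev0 : forall i, 0 <= dev i) by (intros; apply sumR_nonneg; intros; apply pow2_ge_0).
  assert (Hsum : sumR N (fun i => INR n * dev i)
                 = INR n * sqnorm n x - sqnorm N (matvec n A x)).
  { unfold dev. rewrite (sumR_ext N _ (fun i =>
      INR n * sumR n (fun a => v i a ^ 2) + (-1) * (matvec n A x i * matvec n A x i))).
    - rewrite sumR_plus, !sumR_scal, sumR_swap.
      rewrite (sumR_ext n _ (fun a => x a * x a)); [unfold sqnorm; ring|].
      intros a Ha. rewrite <- (Rmult_1_r (x a * x a)), <- (Hcol a Ha).
      unfold sqnorm. rewrite <- sumR_scal. apply sumR_ext; intros; unfold v; ring.
    - intros i _. rewrite <- sumR_variance by lia. unfold matvec, v. ring. }
  assert (Hrow : forall i a, (i < N)%nat -> (a < n)%nat -> v i a = sumR n (v i) / INR n).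
  { intros i a Hi Ha.
    assert (Hd : INR n * dev i = 0).
    { apply (sumR_eq_0 N (fun i => INR n * dev i)); [|lra|exact Hi].
      intros; apply Rmult_le_pos; [lra|apply Hdev0]. }
    assert (Hd0 : dev i = 0) by nra.
    assert (Hsq : (v i a - sumR n (v i) / INR n) ^ 2 = 0).
    { apply (sumR_eq_0 n (fun a => (v i a - sumR n (v i) / INR n) ^ 2));
        [intros; apply pow2_ge_0 | fold (dev i); lra | exact Ha]. }
    nra. }
  set (k := if Nat.eqb j 0 then 1%nat else 0%nat).
  assert (Hk : (k < n)%nat /\ k <> j).
  { unfold k. destruct (Nat.eqb_spec j 0); lia. }
  (* The combination x_j a_j - x_k a_k vanishes in every row, so by independence its coefficient x_j
     is 0. *)
  assert (Hy : x j * e_ j j + - x k * e_ k j = 0).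
  { apply (Hrank (fun l => x j * e_ j l + - x k * e_ k l)); [|exact Hj].
    intros i Hi. rewrite matvec_line by tauto.
    pose proof (Hrow i j Hi Hj) as Hrj. pose proof (Hrow i k Hi (proj1 Hk)) as Hrk.
    unfold v in Hrj, Hrk.
    replace (matvec n A (fun l => x j * e_ j l) i) with (x j * matvec n A (e_ j) i).
    - rewrite matvec_basis by exact Hj. lra.
    - unfold matvec. rewrite <- sumR_scal. apply sumR_ext; intros; ring. }
  unfold e_ in Hy. rewrite Nat.eqb_refl in Hy.
  destruct (Nat.eqb_spec k j); [tauto|lra].
Qed.

Lemma pow_le_half q m : 0 < q < 1 -> ln (1 / 2) / ln q <= INR m -> q ^ m <= 1 / 2.
Proof.
  intros Hq Hm. apply Rnot_lt_le. intros Hlt.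
  apply ln_increasing in Hlt; [|lra]. rewrite ln_pow in Hlt by lra.
  assert (Hln : ln q < 0) by (rewrite <- ln_1; apply ln_increasing; lra).
  apply (Rmult_le_compat_neg_l (ln q)) in Hm; [|lra].
  replace (ln q * (ln (1 / 2) / ln q)) with (ln (1 / 2)) in Hm by (field; lra). lra.
Qed.

Lemma nat_ceil_ge x : x <= INR (nat_ceil x).
Proof.
  unfold nat_ceil. destruct (base_Int_part (- x)) as [Hip _].
  rewrite INR_IZR_INZ.
  (* [Z.to_nat] raises negative values to 0, which only helps a lower bound. *)
  assert (Hz : (- Int_part (- x) <= Z.of_nat (Z.to_nat (- Int_part (- x))))%Z) by lia.
  apply IZR_le in Hz. rewrite opp_IZR in Hz at 1. lra.
Qed.

Theorem theorem4
  (N n : nat) (A : nat -> nat -> R) (b : nat -> R)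
  (HnN : (2 <= n)%nat) (HNn : (n <= N)%nat)
  (* full column rank *)
  (Hrank : forall x : nat -> R,
      (forall i, (i < N)%nat -> matvec n A x i = 0) ->
      forall j, (j < n)%nat -> x j = 0)
  (* columns of unit Euclidean norm *)
  (Hcol : forall j, (j < n)%nat -> sqnorm N (fun i => A i j) = 1)
  (* x* = argmin_x ||Ax - b||_2 *)
  (xstar : nat -> R)
  (Hxstar : forall x : nat -> R,
      sqnorm N (fun i => matvec n A xstar i - b i)
      <= sqnorm N (fun i => matvec n A x i - b i))
  (* rho_2 = max_l (1/n) sum_r X_lr^2 *)
  (rho2 : R)
  (Hrho_ub : forall l, (l < n)%nat ->
      / INR n * sumR n (fun r => gram N A l r ^ 2) <= rho2)
  (Hrho_att : exists l, (l < n)%nat /\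
      / INR n * sumR n (fun r => gram N A l r ^ 2) = rho2)
  (* sigma_max = largest singular value = max_{x<>0} ||Ax||/||x|| *)
  (smax : R) (Hsmax_nn : 0 <= smax)
  (Hsmax_ub : forall x : nat -> R,
      sqnorm N (matvec n A x) <= smax ^ 2 * sqnorm n x)
  (Hsmax_att : exists x : nat -> R, (exists j, (j < n)%nat /\ x j <> 0) /\
      sqnorm N (matvec n A x) = smax ^ 2 * sqnorm n x)
  (* sigma_min = smallest singular value = min_{x<>0} ||Ax||/||x|| (N >= n) *)
  (smin : R) (Hsmin_nn : 0 <= smin)
  (Hsmin_lb : forall x : nat -> R,
      smin ^ 2 * sqnorm n x <= sqnorm N (matvec n A x))
  (Hsmin_att : exists x : nat -> R, (exists j, (j < n)%nat /\ x j <> 0) /\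
      sqnorm N (matvec n A x) = smin ^ 2 * sqnorm n x)
  (* iteration parameters *)
  (beta : R) (Hbeta : 0 <= beta < 1)
  (x0 : nat -> R) (tau : nat)
  (K : nat -> nat -> bool)
  (HK_lo : forall j i, (i + tau + 1 <= j)%nat -> K j i = true)
  (HK_hi : forall j i, K j i = true -> (i < j)%nat)
  (Homega : 0 < 2 * beta * (1 - beta - rho2 * INR tau ^ 2 * beta / 2)) :
  let kappa := smax / smin in
  let omega := 2 * beta * (1 - beta - rho2 * INR tau ^ 2 * beta / 2) in
  let q := 1 - smax ^ 2 / INR n in
  let err := fun m : nat =>
      expect n m (fun s =>
        normX N n A (fun l => iterate N n A b x0 beta K s m l - xstar l)) in
  let e0 := normX N n A (fun l => x0 l - xstar l) in
  (forall m : nat, ln (1 / 2) / ln q <= INR m ->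
     err m <= (1 - omega / (2 * kappa ^ 2)) * e0) /\
  (let T0 := nat_ceil (ln (1 / 2) / ln q) in
   let T := (T0 + tau)%nat in
   let chi := rho2 * INR tau ^ 3 * beta ^ 2 * smax ^ 2 * / (q ^ (2 * tau))
              / INR n in
   forall r m : nat, (1 <= r)%nat -> (r * T <= m)%nat ->
     err m <= (1 - omega / (2 * kappa ^ 2))
              * (1 - omega * q ^ tau / (2 * kappa ^ 2) + chi) ^ (r - 1)
              * e0).
Proof.
  intros kappa omega q err e0.
  assert (Hn0 : (0 < n)%nat) by lia.
  assert (Hn : 0 < INR n) by (apply lt_0_INR; lia).
  assert (Hunit : forall c, (c < n)%nat -> gram N A c c = 1) by exact Hcol.
  (* A unit column as test vector gives smin^2 <= 1 <= smax^2. *)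
  assert (HAe : sqnorm N (matvec n A (e_ 0)) = 1).
  { rewrite <- (Hcol 0%nat Hn0). f_equal. apply functional_extensionality; intros i.
    now apply matvec_basis. }
  pose proof (Hsmax_ub (e_ 0)) as Hmax1. pose proof (Hsmin_lb (e_ 0)) as Hmin1.
  rewrite HAe, sqnorm_basis in Hmax1, Hmin1 by exact Hn0.
  assert (Hsmax : 0 < smax) by nra.
  (* Strictness, from the vector attaining [smax], is what makes [q] positive. *)
  assert (Hsmax_n : smax ^ 2 < INR n).
  { destruct Hsmax_att as (x & Hx & HAx).
    pose proof (operator_norm_lt N n A x HnN Hrank Hcol Hx) as Hlt. rewrite HAx in Hlt.
    pose proof (sqnorm_nonneg n x). nra. }
  assert (Hsmin : 0 < smin).
  { destruct Hsmin_nn as [|Hs0]; [assumption|exfalso].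
    destruct Hsmin_att as (x & (j & Hj & Hxj) & HAx). apply Hxj, Hrank; [|exact Hj].
    intros i Hi.
    assert (Hi0 : matvec n A x i * matvec n A x i = 0).
    { apply (sumR_eq_0 N (fun i => matvec n A x i * matvec n A x i)); [intros; nra| |exact Hi].
      change (sqnorm N (matvec n A x) <= 0). rewrite HAx, <- Hs0. lra. }
    nra. }
  assert (Hlo2 : 0 < smin ^ 2) by (apply pow_lt; exact Hsmin).
  assert (Hhi2 : 0 < smax ^ 2) by (apply pow_lt; exact Hsmax).
  assert (Hq1 : 1 - q = smax ^ 2 / INR n) by (unfold q; ring).
  assert (Hq : 0 < q < 1).
  { assert (0 < smax ^ 2 / INR n < 1); [|lra]. split; [now apply Rdiv_lt_0_compat|].
    apply (Rmult_lt_reg_r (INR n)); [lra|]. field_simplify; lra. }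
  assert (Hlo : 0 < smin ^ 2 / INR n <= 1 - q).
  { split; [now apply Rdiv_lt_0_compat|]. rewrite Hq1. unfold Rdiv.
    apply Rmult_le_compat_r; [left; now apply Rinv_0_lt_compat | lra]. }
  assert (Hrho0 : 0 <= rho2).
  { eapply Rle_trans; [|apply (Hrho_ub 0%nat Hn0)].
    apply Rmult_le_pos; [left; now apply Rinv_0_lt_compat|].
    apply sumR_nonneg; intros; apply pow2_ge_0. }
  assert (Hkappa : forall w, w / (2 * kappa ^ 2)
                             = w * (smin ^ 2 / INR n / (1 - q) / 2)).
  { intros w. rewrite Hq1. unfold kappa. field. lra. }
  (* The horizon stays a parameter: each [err m] is treated with horizon [m], so means over
     different horizons are never compared. *)
  set (F := fun H T l => expect n H (fun s =>
    normX N n A (partial_error N n A b xstar x0 beta K T l s))).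
  set (G := fun H l => expect n H (fun s => gamma N n A b x0 beta K s l ^ 2)).
  assert (Herr : forall m, err m = F m (fun _ => true) m).
  { intros m. unfold err, F. f_equal. apply functional_extensionality; intros s.
    now rewrite partial_error_all. }
  assert (F_0 : forall H T, F H T 0%nat = e0).
  { intros H T. unfold F, e0. rewrite <- (expect_const n H (normX N n A _)) by exact Hn0.
    f_equal. apply functional_extensionality; intros s. f_equal.
    apply functional_extensionality; intros a. unfold partial_error. simpl. ring. }
  assert (F_nonneg : forall H T l, 0 <= F H T l).
  { intros H T l. rewrite <- (expect_const n H 0) by exact Hn0.
    apply expect_le; [exact Hn0|]. intros s _. rewrite normX_sqnorm. apply sqnorm_nonneg. }
  assert (F_ext : forall H T T' l, (forall k, (k < l)%nat -> T k = T' k) -> F H T l = F H T' l).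
  { intros H T T' l HT. apply expect_ext; [exact Hn0|]. intros s _.
    now rewrite (partial_error_ext _ _ _ _ _ _ _ _ _ _ _ _ HT). }
  assert (F_skip : forall H T l, T l = false -> F H T (S l) = F H T l).
  { intros H T l HT. apply expect_ext; [exact Hn0|]. intros s _.
    now rewrite partial_error_skip. }
  assert (F_lower : forall H T l, (l < H)%nat -> q * F H T l <= F H T (S l)).
  { intros H T l Hl. now apply expect_lower. }
  assert (F_upper : forall H T l, (l < H)%nat -> T l = true ->
    (forall k, (k + tau < l)%nat -> T k = K l k) ->
    F H T (S l) <= F H T l - 2 * beta * (1 - beta) * G H l
                   + beta ^ 2 * INR tau * rho2 * sumR tau (back l (G H))).
  { intros H T l Hl HT Hagree. now apply expect_upper. }
  assert (G_lower : forall H l, (l < H)%nat -> smin ^ 2 / INR n * F H (K l) l <= G H l).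
  { intros H l Hl. now apply expect_gam_ge. }
  assert (G_upper : forall H l, (l < H)%nat -> G H l <= (1 - q) * F H (K l) l).
  { intros H l Hl. rewrite Hq1. now apply expect_gam_le. }
  split.
  - intros m Hm. rewrite Herr, Hkappa.
    apply (first_epoch m tau beta rho2 q (smin ^ 2 / INR n) e0 K (F m) (G m)); auto.
    now apply pow_le_half.
  - intros T0 T chi r m Hr Hm. rewrite Herr, !Hkappa.
    replace chi with (rho2 * INR tau ^ 3 * beta ^ 2 * (1 - q) / q ^ (2 * tau)).
    + apply (all_epochs m tau beta rho2 q (smin ^ 2 / INR n) e0 K (F m) (G m)) with (T0 := T0);
        auto.
      apply pow_le_half; [exact Hq | apply nat_ceil_ge].
    + unfold chi. rewrite Hq1. field. split; [|lra]. apply pow_nonzero; lra.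
Qed.
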